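(* Let $G$ be a finite simple graph with $n$ edges and let $r\ge2$ be an integer. Then $\omega(I_{\mathcal{P}_G})\le r$ if and only if for every $\mathbf{a}\in\mathbb{Z}_{\ge0}^n$, every $k$, and all $k$-edge-colorings $f$ and $g$ of the edge-replication multigraph $G^{(e)}_{\mathbf{a}}$ such that each color of $f$ and of $g$ corresponds to a perfect matching of $G$, one has $f\sim_r g$.
   Context: Let $G$ have edge set $E(G)=\{e_1,\dots,e_n\}$. A perfect matching of $G$ is a set of pairwise non-adjacent edges covering every vertex. For $M\subset E(G)$ put $\rho(M)=\sum_{e_j\in M}\mathbf{e}_j\in\mathbb{R}^n$. The perfect matching polytope is $\mathcal{P}_G=\mathrm{conv}\{\rho(M): M \text{ a perfect matching of } G\}\subset\mathbb{R}^n$ (possibly empty, in which case $I_{\mathcal{P}_G}=\{0\}$). Toric ideal: for a lattice polytope $\mathcal{P}\subset\mathbb{R}^n_{\ge0}$ with $\mathcal{P}\cap\mathbb{Z}^n=\{\mathbf{a}_1,\dots,\mathbf{a}_N\}$ and a field $\mathbb{K}$, $I_{\mathcal{P}}$ is the kernel of the $\mathbb{K}$-algebra map $\mathbb{K}[x_1,\dots,x_N]\to\mathbb{K}[t_1,\dots,t_n,s]$, $x_i\mapsto \mathbf{t}^{\mathbf{a}_i}s$, with $\deg x_i=1$. For a homogeneous ideal $I$, $\omega(I)$ is the maximal degree of minimal generators of $I$; by convention $\omega(\{0\})=2$ (so $\omega(I_{\mathcal P})\ge 2$ always). For $\mathbf{a}=(a_1,\dots,a_n)\in\mathbb{Z}_{\ge0}^n$,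 the edge-replication multigraph $G^{(e)}_{\mathbf{a}}$ is the multigraph on $V(G)$ having $a_i$ parallel copies of the edge $e_i$ for each $i$ (none if $a_i=0$). A $k$-edge-coloring of a multigraph is an assignment of colors from $\{1,\dots,k\}$ to the edges such that distinct edges sharing a vertex get different colors. For a $k$-edge-coloring $f$ and a color $j$, $M^{(e)}(f,j)$ is the set of edges of color $j$; color $j$ of $f$ corresponds to a perfect matching of $G$ if the set of edges of $G$ of which the elements of $M^{(e)}(f,j)$ are copies is a perfect matching of $G$. Two $k$-edge-colorings $f,g$ differ by an $m$-colored subgraph if there is a set $S$ of $m$ colors with $M^{(e)}(f,j)\ne M^{(e)}(g,j)$ for $j\in S$ and $M^{(e)}(f,j)=M^{(e)}(g,j)$ for $j\notin S$. Write $f\sim_r g$ if there is a sequence $f=f_0,f_1,\dots,f_s=g$ of $k$-edge-colorings of the multigraph such that $f_i$ differs from $f_{i-1}$ by a $k_i$-colored subgraph with $k_i\le r$ for each $i$. *)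

(* Defs.v *)
From HB Require Import structures.
From mathcomp Require Import all_boot all_order all_algebra.
From mathcomp Require Import finmap mpoly.
From mathcomp Require Import boolp classical_sets cardinality reals.

Set Implicit Arguments.
Unset Strict Implicit.
Unset Printing Implicit Defensive.

Import GRing.Theory.
Local Open Scope ring_scope.

Record simple_graph (V : finType) := SimpleGraph {
  adj : rel V;
  adj_sym : ssrbool.symmetric adj;
  adj_irr : irreflexive adj }.

Definition edges (V : finType) (G : simple_graph V) : {set {set V}} :=
  [set [set p.1; p.2]%SET | p in [set p : V * V | adj G p.1 p.2]%SET]%SET.

Definition edge (V : finType) (G : simple_graph V) (i : 'I_#|edges G|) :
  {set V} := enum_val i.

Definition is_perfect_matching (V : finType) (G : simple_graph V)
    (M : {set {set V}}) : bool :=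
  [&& M \subset edges G, finset.trivIset M & finset.cover M == [set: V]%SET].

Definition rho (R : realType) (V : finType) (G : simple_graph V)
    (M : {set {set V}}) : 'rV[R]_#|edges G| :=
  \sum_(j < #|edges G| | edge j \in M) delta_mx 0 j.

Definition conv (R : realType) (n : nat) (A : set 'rV[R]_n) : set 'rV[R]_n :=
  [set x | exists (m : nat) (c : 'I_m -> R) (p : 'I_m -> 'rV[R]_n),
     [/\ forall i, A (p i), forall i, 0 <= c i, \sum_i c i = 1
       & x = \sum_i c i *: p i]]%classic.

Definition perfect_matching_polytope (R : realType) (V : finType)
    (G : simple_graph V) : set 'rV[R]_#|edges G| :=
  conv [set rho R G M | M in [set M | is_perfect_matching G M]]%classic.

Arguments perfect_matching_polytope R {V} G.

(* The polytopes considered lie in the nonnegative orthant, so their integer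
   points are exponent vectors. [fset_set] is the empty set on infinite sets;
   bounded sets have finitely many integer points. *)
Definition lattice_points (R : realType) (n : nat) (P : set 'rV[R]_n) :
    seq 'X_{1..n} :=
  enum_fset (fset_set [set a : 'X_{1..n} | P (\row_i (a i)%:R)]%classic).

(* [K[t_1, ..., t_n, s]] is [{mpoly K[n.+1]}], where [s] is the last
   variable. *)
Definition toric_monomial (K : fieldType) (n : nat) (a : 'X_{1..n}) :
  {mpoly K[n.+1]} := mwiden 'X_[a] * 'X_ord_max.

Definition toric_map (R : realType) (K : fieldType) (n : nat)
    (P : set 'rV[R]_n) :
    {mpoly K[size (lattice_points P)]} -> {mpoly K[n.+1]} :=
  comp_mpoly (map_tuple (@toric_monomial K n) (in_tuple (lattice_points P))).

Definition toric_ideal (R : realType) (K : fieldType) (n : nat)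
    (P : set 'rV[R]_n) : set {mpoly K[size (lattice_points P)]} :=
  [set f | toric_map f = 0]%classic.

Arguments toric_ideal {R} K {n} P.

Definition ideal_gen (K : fieldType) (N : nat) (S : seq {mpoly K[N]}) :
    set {mpoly K[N]} :=
  [set f | exists c : 'I_(size S) -> {mpoly K[N]},
     f = \sum_(i < size S) c i * S`_i]%classic.

Definition minimal_generating_set (K : fieldType) (N : nat)
    (I : set {mpoly K[N]}) (S : seq {mpoly K[N]}) : Prop :=
  [/\ forall f, f \in S -> exists d, f \is d.-homog,
      ideal_gen S = I
    & forall S' : seq {mpoly K[N]}, {subset S' <= S} -> ideal_gen S' = I ->
        {subset S <= S'}].

Definition minimal_generator (K : fieldType) (N : nat)
    (I : set {mpoly K[N]}) (f : {mpoly K[N]}) : Prop :=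
  exists2 S, minimal_generating_set I S & f \in S.

(* The zero ideal has no minimal generator, and [supremum 2] takes the value 2
   on the empty set, which is the convention for the zero ideal. For a nonzero
   homogeneous ideal, the degrees of minimal generators form a nonempty bounded
   set of natural numbers, whose supremum is its maximum. *)
Definition omega (K : fieldType) (N : nat) (I : set {mpoly K[N]}) : nat :=
  supremum 2%N [set (msize f).-1 | f in minimal_generator I]%classic.

Record multigraph (V : finType) := Multigraph {
  medge : finType;
  mends : medge -> {set V} }.

Definition edge_replication (V : finType) (G : simple_graph V)
    (a : 'I_#|edges G| -> nat) : multigraph V :=
  @Multigraph V {i : 'I_#|edges G| & 'I_(a i)} (fun e => edge (tag e)).

Definition is_edge_coloring (V : finType) (H : multigraph V) (k : nat)
    (f : {ffun medge H -> 'I_k}) : Prop :=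
  forall e e', e != e' -> ~~ [disjoint mends e & mends e'] -> f e != f e'.

Definition color_class (V : finType) (H : multigraph V) (k : nat)
    (f : {ffun medge H -> 'I_k}) (j : 'I_k) : {set medge H} :=
  [set e | f e == j]%SET.

Definition color_perfect_matching (V : finType) (G : simple_graph V)
    (a : 'I_#|edges G| -> nat) (k : nat)
    (f : {ffun medge (edge_replication a) -> 'I_k}) (j : 'I_k) : Prop :=
  is_perfect_matching G [set mends e | e in color_class f j]%SET.

Definition differ_by (V : finType) (H : multigraph V) (k m : nat)
    (f g : {ffun medge H -> 'I_k}) : Prop :=
  exists S : {set 'I_k},
    [/\ #|S| = m,
        forall j, j \in S -> color_class f j <> color_class g j
      & forall j, j \notin S -> color_class f j = color_class g j].

Definition coloring_equiv (V : finType) (H : multigraph V) (k r : nat)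
    (f g : {ffun medge H -> 'I_k}) : Prop :=
  exists (s : nat) (F : nat -> {ffun medge H -> 'I_k}),
    [/\ F 0%N = f, F s = g,
        forall i, (i <= s)%N -> is_edge_coloring (F i)
      & forall i, (i < s)%N ->
          exists2 m, (m <= r)%N & differ_by m (F i) (F i.+1)].

(* Main.v *)
(* The toric ideal is spanned by the binomials x^u - x^v whose two monomials
   have the same image, and it is generated in degrees at most r exactly when
   any two such monomials are joined by moves w + x -> w + y with x and y of
   equal image and of degree at most r: the sum of the coefficients over a
   class of move-connected exponents is a linear form that vanishes on the ideal
   generated in degrees at most r. Finite generation, needed for the maximal
   degree of minimal generators to control the whole ideal, comes from Dickson's
   lemma (a Graver basis).

   The lattice points of the polytope are the indicator vectors of perfect
   matchings, so a coloring of G_a whose classes are perfect matchings yields a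
   monomial of degree k with image a, and all such monomials arise. The monomial
   forgets only the order of the colors and which parallel copy carries which
   color, and both can be corrected by changing two colors at a time, which is
   why r >= 2 is needed. *)
From HB Require Import structures.
Require Import Defs.
From mathcomp Require Import all_boot all_order all_algebra.
From mathcomp Require Import perm finmap mpoly ssrcomplements.
From mathcomp Require Import boolp classical_sets cardinality reals.
From mathcomp Require Import zify.
From Stdlib Require Import Relations.

Set Implicit Arguments.
Unset Strict Implicit.
Unset Printing Implicit Defensive.

Import Order.TTheory GRing.Theory Num.Theory.
Local Open Scope ring_scope.

(** * Finitely generated ideals, minimal generators and [omega] *)

Section IdealGen.
Variables (K : fieldType) (N : nat).
Implicit Types (S : seq {mpoly K[N]}) (f g : {mpoly K[N]}).

Lemma ideal_gen0 S : ideal_gen S 0.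
Proof. by exists (fun=> 0); rewrite big1 // => i _; rewrite mul0r. Qed.

Lemma ideal_genD S f g : ideal_gen S f -> ideal_gen S g -> ideal_gen S (f + g).
Proof.
move=> [c ->] [d ->]; exists (fun i => c i + d i).
by rewrite -big_split /=; apply: eq_bigr => i _; rewrite mulrDl.
Qed.

Lemma ideal_genM S c f : ideal_gen S f -> ideal_gen S (c * f).
Proof.
move=> [d ->]; exists (fun i => c * d i).
by rewrite mulr_sumr; apply: eq_bigr => i _; rewrite mulrA.
Qed.

Lemma ideal_gen_sum S (T : eqType) (s : seq T) (P : pred T)
    (F : T -> {mpoly K[N]}) :
  (forall i, i \in s -> P i -> ideal_gen S (F i)) ->
  ideal_gen S (\sum_(i <- s | P i) F i).
Proof.
move=> H; rewrite big_seq_cond.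
apply: (big_ind (ideal_gen S)) => [|x y|i /andP[]].
- exact: ideal_gen0.
- exact: ideal_genD.
- exact: H.
Qed.

Lemma ideal_gen_mem S f : f \in S -> ideal_gen S f.
Proof.
move=> fS; have lt : (index f S < size S)%N by rewrite index_mem.
exists (fun i : 'I_(size S) => (i == Ordinal lt)%:R).
rewrite (bigD1 (Ordinal lt)) //= eqxx mul1r nth_index // big1 ?addr0 //.
by move=> i /negPf ->; rewrite mul0r.
Qed.

Lemma ideal_genE S (I : set {mpoly K[N]}) :
  (forall f g, I f -> I g -> I (f + g)) -> I 0 ->
  (forall c f, I f -> I (c * f)) -> (forall f, f \in S -> I f) ->
  (ideal_gen S `<=` I)%classic.
Proof.
move=> ID I0 IM SI f [c ->]; apply: (big_ind I) => // i _.
by apply/IM/SI/mem_nth.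
Qed.

Lemma ideal_gen_trans S S' :
  (forall f, f \in S -> ideal_gen S' f) -> (ideal_gen S `<=` ideal_gen S')%classic.
Proof.
apply: ideal_genE; [exact: ideal_genD|exact: ideal_gen0|exact: ideal_genM].
Qed.

Lemma sub_ideal_gen S S' : {subset S <= S'} -> (ideal_gen S `<=` ideal_gen S')%classic.
Proof. by move=> sub; apply: ideal_gen_trans => f /sub /ideal_gen_mem. Qed.

(* The degree-d component of a combination only involves generators of degree
   at most d. *)
Lemma ideal_gen_homog S d g :
  (forall f, f \in S -> exists e, f \is e.-homog) ->
  ideal_gen S g -> g \is d.-homog ->
  ideal_gen [seq f <- S | ((msize f).-1 <= d)%N] g.
Proof.
move=> homS [c gE] gd; rewrite -(pihomog_dE gd) gE raddf_sum /=.
apply: ideal_gen_sum => i _ _.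
have Si : S`_i \in S by apply: mem_nth.
have [e he] := homS _ Si.
rewrite {1}(mpolyE (c i)) mulr_suml raddf_sum /=.
apply: ideal_gen_sum => m _ _.
rewrite -scalerAl linearZ /= -mul_mpolyC; apply: ideal_genM.
have hm : ('X_[m] * S`_i : {mpoly K[N]}) \is (mdeg m + e).-homog.
  by apply: dhomogM => //; rewrite dhomogX.
have [dE|dN] := eqVneq (mdeg m + e)%N d; last first.
  by rewrite (pihomog_ne0 dN hm); apply: ideal_gen0.
rewrite -dE (pihomog_dE hm); apply: ideal_genM.
apply: ideal_gen_mem; rewrite mem_filter Si andbT dE.
have [->|nz] := eqVneq S`_i 0; first by rewrite msize0.
have := dhomog_uniq nz he (dhomog_msize he) => <-; lia.
Qed.

(** Discarding from a minimal generating set [S] the elements of degree above [D] loses nothing: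
    each [g] in [S0] is homogeneous of degree at most [D], hence still generated. Minimality then
    puts [f] among the elements kept. *)
Lemma minimal_generator_degree (I : set {mpoly K[N]}) S0 D f :
  ideal_gen S0 = I ->
  (forall g, g \in S0 -> exists2 d, (d <= D)%N & g \is d.-homog) ->
  minimal_generator I f -> ((msize f).-1 <= D)%N.
Proof.
move=> S0I hS0 [S [homS SI minS] fS].
have sub : {subset [seq f <- S | ((msize f).-1 <= D)%N] <= S}.
  by move=> x; rewrite mem_filter => /andP[].
have /(_ _) := minS _ sub.
have -> : ideal_gen [seq f <- S | ((msize f).-1 <= D)%N] = I.
  apply/seteqP; split; first by rewrite -SI; apply: sub_ideal_gen.
  rewrite -S0I; apply: ideal_gen_trans => g gS0.
  have [d dD gd] := hS0 _ gS0.
  have : ideal_gen S g by rewrite SI -S0I; apply: ideal_gen_mem.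
  move/(fun h => ideal_gen_homog homS h gd); apply: sub_ideal_gen => x.
  rewrite !mem_filter => /andP[/leq_trans xd ->]; rewrite andbT; exact: xd.
by move=> /(_ erefl f fS); rewrite mem_filter => /andP[].
Qed.

Lemma omega_le (I : set {mpoly K[N]}) S0 r : (2 <= r)%N ->
  ideal_gen S0 = I ->
  (forall g, g \in S0 -> exists2 d, (d <= r)%N & g \is d.-homog) ->
  (omega I <= r)%N.
Proof.
(* [supremum] falls back to 2 on the empty set and when no supremum exists; [r2] covers both
   cases. *)
move=> r2 S0I hS0; rewrite /omega /supremum; case: ifPn => // _.
case: xgetP => [x _ [_ lb]|_] //.
by apply: lb => _ [f fI <-]; exact: minimal_generator_degree S0I hS0 fI.
Qed.

Lemma exists_minimal_generating_set (I : set {mpoly K[N]}) S0 :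
  (forall f, f \in S0 -> exists d, f \is d.-homog) ->
  ideal_gen S0 = I -> exists S, minimal_generating_set I S.
Proof.
move: {2}(size S0) (leqnn (size S0)) => n.
elim: n S0 => [|n IH] S0 szS0 homS S0I.
  move: szS0; rewrite leqn0 => /nilP S00; exists S0; split=> // S' _ _ f.
  by rewrite S00.
case: (pselect (minimal_generating_set I S0)) => [|nmin]; first by exists S0.
have [S' [sub S'I nsub]] : exists S' : seq {mpoly K[N]},
    [/\ {subset S' <= S0}, ideal_gen S' = I & ~ {subset S0 <= S'}].
  apply: contrapT => H; apply: nmin; split=> // S' sub S'I.
  by apply: contrapT => nsub; apply: H; exists S'.
(* [S'] may repeat elements of [S0]; only after removing duplicates is it sure to be shorter than
   [S0]. *)
have sub' : {subset undup S' <= S0} by move=> f; rewrite mem_undup; apply: sub.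
apply: (IH (undup S')).
- rewrite -ltnS (leq_trans _ szS0) // ltnNge; apply/negP => le.
  have [_ eqi] := uniq_min_size (undup_uniq S') sub' le.
  by apply: nsub => f; rewrite -eqi mem_undup.
- by move=> f /sub' /homS.
- rewrite -S'I; apply/seteqP; split; apply: sub_ideal_gen => f;
    by rewrite mem_undup.
Qed.

(** The degrees in [S0] bound those of all minimal generators, so [omega I] is a genuine upper bound
    and any minimal generating set will do. *)
Lemma omega_ge (I : set {mpoly K[N]}) S0 :
  (forall f, f \in S0 -> exists d, f \is d.-homog) ->
  ideal_gen S0 = I ->
  exists2 S, ideal_gen S = I &
    forall f, f \in S -> exists2 d, (d <= omega I)%N & f \is d.-homog.
Proof.
move=> homS0 S0I; have [S minS] := exists_minimal_generating_set homS0 S0I.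
case: (minS) => homS SI _; exists S => // f fS.
(* The degree is read off [msize], since for [f = 0] the given [d] is arbitrary. *)
have [d fd] := homS f fS; exists (msize f).-1; last exact: dhomog_msize fd.
rewrite /omega.
have fA : [set (msize f).-1 | f in minimal_generator I]%classic (msize f).-1.
  by exists f => //; exists S.
rewrite -leEnat; apply: (ge_supremum_Nmem 2%N (nat_supremums_neq0 _) fA).
exists (\max_(g <- S0) (msize g).-1)%N => _ [g gI <-].
apply: (minimal_generator_degree S0I _ gI) => h hS0.
exists (msize h).-1; first exact: leq_bigmax_seq.
by have [e he] := homS0 h hS0; apply: dhomog_msize he.
Qed.

End IdealGen.

(* Induction on the coordinates: a point whose coordinate i is at least the
   largest one in the finite set s0 obtained for the other coordinates dominates
   an element of s0; the remaining points lie on finitely many slices. *)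
Lemma dickson (T X : eqType) (ev : T -> X -> nat) (l : seq T) (Q : X -> Prop) :
  exists2 s : seq X, (forall x, x \in s -> Q x) &
    forall x, Q x -> exists2 y, y \in s & {in l, forall i, (ev i y <= ev i x)%N}.
Proof.
elim: l Q => [|i l IH] Q.
  have [[x Qx]|nQ] := pselect (exists x, Q x).
    exists [:: x] => [y|y _]; first by rewrite inE => /eqP ->.
    by exists x; rewrite ?inE.
  by exists [::] => // x Qx; case: nQ; exists x.
have [s0 s0Q s0P] := IH Q.
have /choice[F HF] : forall n, exists s : seq X,
    (forall x, x \in s -> Q x /\ ev i x = n) /\
    forall x, Q x /\ ev i x = n ->
      exists2 y, y \in s & {in l, forall i, (ev i y <= ev i x)%N}.
  by move=> n; have [s] := IH (fun x => Q x /\ ev i x = n); exists s.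
pose Y := (\max_(x <- s0) ev i x)%N.
exists (s0 ++ flatten [seq F n | n <- iota 0 Y]) => [x|x Qx].
  rewrite mem_cat => /orP[/s0Q //|/flatten_mapP[n _ xF]].
  by have [/(_ _ xF)[]] := HF n.
have [ltY|leY] := ltnP (ev i x) Y.
  have [sub /(_ x (conj Qx erefl)) [y yF yx]] := HF (ev i x).
  exists y => [|j]; last first.
    by rewrite inE => /orP[/eqP ->|/yx //]; have [_ ->] := sub _ yF.
  rewrite mem_cat; apply/orP; right; apply/flatten_mapP.
  by exists (ev i x); rewrite ?mem_iota.
have [y ys yx] := s0P x Qx; exists y => [|j]; first by rewrite mem_cat ys.
rewrite inE => /orP[/eqP ->|/yx //]; apply: leq_trans leY.
exact: leq_bigmax_seq.
Qed.

(** * The linear form summing coefficients over a class of exponents *)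

Section ClassSum.
Variables (K : fieldType) (N : nat) (Q : pred 'X_{1..N}).

Definition class_sum (f : {mpoly K[N]}) : K := \sum_(m <- msupp f | Q m) f@_m.

(** Gives polynomials with different supports a common index set, from which linearity is read off
    termwise. *)
Lemma class_sumwE k f : (msize f <= k)%N ->
  class_sum f = \sum_(m : 'X_{1..N < k} | Q m) f@_m.
Proof.
move=> lt_fk; rewrite /class_sum (big_mksub_cond 'X_{1..N < k}) //=; first last.
- by move=> x /msize_mdeg_lt /leq_trans /(_ lt_fk) ->.
- by rewrite msupp_uniq.
by rewrite -big_filter_cond big_rmcond ?big_filter //= => m /memN_msupp_eq0 ->.
Qed.

Lemma class_sum_is_linear : linear_for *%R class_sum.
Proof.
move=> c f g; pose k := maxn (msize (c *: f + g)) (maxn (msize f) (msize g)).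
rewrite !(@class_sumwE k) ?leq_max ?leqnn ?orbT //.
rewrite mulr_sumr -big_split /=; apply: eq_bigr => m _.
by rewrite mcoeffD mcoeffZ.
Qed.

HB.instance Definition _ :=
  GRing.isLinear.Build K {mpoly K[N]} K _ class_sum class_sum_is_linear.

Lemma class_sumX m : class_sum 'X_[m] = (Q m)%:R.
Proof. by rewrite /class_sum msuppX big_mkcond big_seq1 mcoeffX eqxx; case: (Q m). Qed.

End ClassSum.

(** * Kernels of monomial maps and connectedness of their fibres *)

Section MonomialMap.
Variables (K : fieldType) (N p : nat) (b : 'I_N -> 'X_{1..p}).

Definition mon_image (m : 'X_{1..N}) : 'X_{1..p} := (\sum_i b i *+ m i)%MM.

Lemma mon_imageD u v : mon_image (u + v) = (mon_image u + mon_image v)%MM.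
Proof.
rewrite /mon_image -big_split /=; apply: eq_bigr => i _.
by rewrite mnmDE; apply/mnmP => j; rewrite !(mulmnE, mnmDE) mulnDr.
Qed.

(** The step along a kernel binomial of degree at most [r] multiplied by the monomial of exponent
    [w]. Under [image_deg] the bound on [mdeg x] also bounds [mdeg y]. *)
Definition move_le (r : nat) (u v : 'X_{1..N}) : Prop :=
  exists w x y, [/\ u = (w + x)%MM, v = (w + y)%MM,
    mon_image x = mon_image y & (mdeg x <= r)%N].

Definition moves_le r := clos_refl_trans _ (move_le r).

Variable t : N.-tuple {mpoly K[p]}.
Hypothesis tE : forall i, tnth t i = 'X_[b i].

Lemma comp_mon_image m : 'X_[m] \mPo t = 'X_[mon_image m].
Proof.
rewrite comp_mpolyX /mon_image.
rewrite (eq_bigr (fun i => 'X_[b i *+ m i])); last first.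
  by move=> i _; rewrite tE mpolyXn.
by rewrite mprodXE.
Qed.

Lemma binomial_ker u v : mon_image u = mon_image v ->
  ('X_[u] - 'X_[v] : {mpoly K[N]}) \mPo t = 0.
Proof. by move=> uv; rewrite comp_mpolyB !comp_mon_image uv subrr. Qed.

(* Subtracting from every monomial a representative of its fibre does not
   change f, because the coefficients of f sum to 0 on each fibre. *)
Lemma ker_binomial (f : {mpoly K[N]}) : f \mPo t = 0 ->
  exists2 h : 'X_{1..N} -> 'X_{1..N},
    (forall m, m \in msupp f -> h m \in msupp f /\ mon_image (h m) = mon_image m) &
    f = \sum_(m <- msupp f) f@_m *: ('X_[m] - 'X_[h m]).
Proof.
move=> f0.
have sum0 y : \sum_(m <- msupp f | mon_image m == y) f@_m = 0.
  transitivity ((f \mPo t)@_y); last by rewrite f0 mcoeff0.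
  rewrite comp_mpolyEX raddf_sum [LHS]big_mkcond /=.
  apply: eq_bigr => m _.
  rewrite comp_mon_image mcoeffZ mcoeffX.
  by case: eqP; rewrite ?mulr1 ?mulr0.
(* The representative is the first exponent of the support over [y]; the default [0] is not reached
   when [y] is the image of an exponent in the support. *)
pose H y := head 0%MM [seq m <- msupp f | mon_image m == y].
exists (H \o mon_image) => [m mf|].
  have : H (mon_image m) \in [seq m' <- msupp f | mon_image m' == mon_image m].
    have : m \in [seq m' <- msupp f | mon_image m' == mon_image m].
      by rewrite mem_filter eqxx.
    by rewrite /H; case: [seq _ <- _ | _] => //= x s _; rewrite inE eqxx.
  by rewrite mem_filter => /andP[/eqP ? ?].
under eq_bigr do rewrite scalerBr.
rewrite sumrB -mpolyE; apply/esym/eqP; rewrite subr_eq addrC -subr_eq subrr.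
apply/eqP/esym => /=.
(* Grouped by image [y], the representatives contribute ['X_[H y]] times a fibre sum, which is 0. *)
pose Y := undup [seq mon_image m | m <- msupp f].
transitivity (\sum_(m <- msupp f) \sum_(y <- Y | mon_image m == y)
                f@_m *: ('X_[H y] : {mpoly K[N]})).
  apply: eq_big_seq => m mf; rewrite big_mkcond.
  rewrite (bigD1_seq (mon_image m)) ?undup_uniq ?mem_undup ?map_f //= eqxx.
  by rewrite big1 ?addr0 // => y /negPf; rewrite eq_sym => ->.
rewrite (exchange_big_dep xpredT) //= big1 // => y _.
by rewrite -scaler_suml sum0 scale0r.
Qed.

Hypothesis image_deg : forall u v, mon_image u = mon_image v -> mdeg u = mdeg v.

Definition ker_set : set {mpoly K[N]} := [set f | f \mPo t = 0]%classic.

Lemma ker_gen S :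
  (forall f, f \in S -> ker_set f) ->
  (forall u v, mon_image u = mon_image v ->
     ideal_gen S ('X_[u] - 'X_[v] : {mpoly K[N]})) ->
  ideal_gen S = ker_set.
Proof.
move=> SI HS; apply/seteqP; split.
  apply: ideal_genE => //; rewrite /ker_set /=.
  - by move=> f g f0 g0; rewrite comp_mpolyD f0 g0 addr0.
  - by rewrite comp_mpoly0.
  - by move=> c f f0; rewrite rmorphM /= f0 mulr0.
move=> f /ker_binomial[h hP ->]; apply: ideal_gen_sum => m mf _.
rewrite -mul_mpolyC; apply: ideal_genM; apply: HS.
by have [_ ->] := hP _ mf.
Qed.

Lemma binomial_homog u v : mon_image u = mon_image v ->
  ('X_[u] - 'X_[v] : {mpoly K[N]}) \is (mdeg u).-homog.
Proof.
by move=> /image_deg uv; apply: rpredB; rewrite dhomogX; apply/eqP.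
Qed.

(* The pairs of distinct exponents with equal image that are minimal for the
   componentwise order give a finite generating set (the Graver basis). *)
Lemma ker_fin_gen : exists2 S,
  (forall f, f \in S -> exists d, f \is d.-homog) & ideal_gen S = ker_set.
Proof.
(* A pair of exponents is read as one vector with [2 * N] coordinates; the boolean selects the
   component. *)
pose ev (i : bool * 'I_N) (x : 'X_{1..N} * 'X_{1..N}) := if i.1 then x.1 i.2 else x.2 i.2.
have [s sQ sP] := dickson ev (enum {: bool * 'I_N})
  (fun x => mon_image x.1 = mon_image x.2 /\ x.1 <> x.2).
exists [seq 'X_[x.1] - 'X_[x.2] | x : _ * _ <- s].
  move=> _ /mapP[x /sQ[xE _] ->]; exists (mdeg x.1); exact: binomial_homog.
apply: ker_gen.
  by move=> _ /mapP[x /sQ[xE _] ->]; apply: binomial_ker.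
move=> u; move: {2}(mdeg u) (leqnn (mdeg u)) => n.
elim: n u => [|n IH] u un v uv.
  have /eqP u0 : u == 0%MM by rewrite -mdeg_eq0 -leqn0.
  have /eqP v0 : v == 0%MM by rewrite -mdeg_eq0 -(image_deg uv) -leqn0.
  by rewrite u0 v0 subrr; apply: ideal_gen0.
have [->|/eqP nuv] := eqVneq u v; first by rewrite subrr; apply: ideal_gen0.
have [[u' v'] xs xle] := sP (u, v) (conj uv nuv).
have [/= uv' nuv'] := sQ _ xs.
have u'u : (u' <= u)%MM.
  by apply/mnm_lepP => i; apply: (xle (true, i)); rewrite mem_enum.
have v'v : (v' <= v)%MM.
  by apply/mnm_lepP => i; apply: (xle (false, i)); rewrite mem_enum.
have uvd : mon_image (u - u') = mon_image (v - v').
  apply: (@addIm _ (mon_image u')); rewrite -mon_imageD submK // uv uv'.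
  by rewrite -mon_imageD submK.
(* First [u'] is traded for [v'] inside [u]; then [v'] is a common factor and the cofactors have
   smaller degree. *)
have -> : 'X_[u] - 'X_[v] = 'X_[(u - u')%MM] * ('X_[u'] - 'X_[v']) +
    'X_[v'] * ('X_[(u - u')%MM] - 'X_[(v - v')%MM]) :> {mpoly K[N]}.
  rewrite !mulrBr -!mpolyXD submK // [(v' + (v - v'))%MM]addmC submK //.
  by rewrite [(v' + _)%MM]addmC addrA subrK.
apply: ideal_genD; apply: ideal_genM.
  by apply: ideal_gen_mem; apply/mapP; exists (u', v').
(* If [u'] were 0, then [v'] would have degree 0 as well, against [u' <> v']; so the degree drops
   strictly. *)
apply: IH => //; have : mdeg u' != 0%N.
  rewrite mdeg_eq0; apply/eqP => u'0; apply: nuv'; rewrite u'0.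
  by apply/esym/eqP; rewrite -mdeg_eq0 -(image_deg uv') u'0 mdeg0.
by have := mdegD (u - u') u'; rewrite submK //; lia.
Qed.

Lemma move_le_sym r u v : move_le r u v -> move_le r v u.
Proof.
move=> [w [x [y [-> -> xy xr]]]]; exists w, y, x; split=> //.
by rewrite -(image_deg xy).
Qed.

Lemma omega_moves r u v :
  (omega ker_set <= r)%N -> mon_image u = mon_image v -> moves_le r u v.
Proof.
move=> omr uv; apply: contrapT => nuv.
have [S0 homS0 S0I] := ker_fin_gen; have [S SI hS] := omega_ge homS0 S0I.
pose Q m := `[< moves_le r u m >].
have Qmove x y : move_le r x y -> Q x = Q y.
  move=> xy; apply/asboolP/asboolP => h; apply: (rt_trans _ _ _ _ _ h);
    apply: rt_step => //; exact: move_le_sym.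
(* Each term of [c * f] is a scalar times a difference of two monomials one move apart, on which [Q]
   agrees. *)
have Q0 f : f \in S -> forall c, class_sum Q (c * f) = 0.
  move=> fS c; have [d dr fd] := hS _ fS.
  have : ker_set f by rewrite -SI; apply: ideal_gen_mem.
  move=> /ker_binomial[h hP fE].
  rewrite fE (mpolyE c) mulr_suml raddf_sum big1_seq //= => w _.
  rewrite mulr_sumr raddf_sum big1_seq //= => m mf.
  have [_ hm] := hP m mf.
  rewrite -scalerAl -scalerAr scalerA mulrBr -!mpolyXD linearZ /= linearB /=.
  rewrite !class_sumX (Qmove (w + m)%MM (w + h m)%MM) ?subrr ?mulr0 //.
  exists w, m, (h m); split=> //.
  by rewrite (dhomog_mf fd mf) (leq_trans dr).
have : ideal_gen S ('X_[u] - 'X_[v]) by rewrite SI; apply: binomial_ker.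
move=> [c /(congr1 (class_sum Q))]; rewrite linearB /= !class_sumX.
rewrite raddf_sum big1 => [|i _]; last by apply: Q0; apply: mem_nth.
have -> : Q u by apply/asboolP; apply: rt_refl.
have -> : Q v = false by apply/asboolP.
by move/eqP; rewrite subr0 oner_eq0.
Qed.

Lemma moves_omega r : (2 <= r)%N ->
  (forall u v, mon_image u = mon_image v -> moves_le r u v) ->
  (omega ker_set <= r)%N.
Proof.
move=> r2 H.
(* All kernel binomials of degree at most [r]; the strict degree bound of bounded exponents accounts
   for [r.+1]. *)
pose S := [seq 'X_[bmnm x.1] - 'X_[bmnm x.2] : {mpoly K[N]} |
  x : _ * _ <- enum {: 'X_{1..N < r.+1, r.+1}} & mon_image (bmnm x.1) == mon_image (bmnm x.2)].
have SP f : f \in S -> exists x : 'X_{1..N < r.+1, r.+1},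
    mon_image x.1 = mon_image x.2 /\ f = 'X_[bmnm x.1] - 'X_[bmnm x.2].
  by move=> /mapP[x]; rewrite mem_filter => /andP[/eqP xE _] ->; exists x.
apply: (@omega_le _ _ _ S) => //; last first.
  move=> _ /SP[x [xE ->]]; exists (mdeg x.1); last exact: binomial_homog.
  by rewrite -ltnS bmdeg.
apply: ker_gen => [_ /SP[x [xE ->]]|u v uv]; first exact: binomial_ker.
elim: (H u v uv) => {u v uv} [u v|u|u v w _ IH1 _ IH2].
- move=> [w [x [y [-> -> xy xr]]]].
  have xr' : (mdeg x < r.+1)%N by [].
  have yr' : (mdeg y < r.+1)%N by rewrite -(image_deg xy).
  rewrite !mpolyXD -mulrBr; apply: ideal_genM; apply: ideal_gen_mem.
  apply/mapP; exists (BMultinom xr', BMultinom yr') => //.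
  by rewrite mem_filter /= xy eqxx mem_enum.
- by rewrite subrr; apply: ideal_gen0.
- by rewrite -(subrK 'X_[v] 'X_[u]) -addrA; apply: ideal_genD.
Qed.

End MonomialMap.

(** Elements are matched by their rank in the two enumerations, and [x] serves as its own default in
    [nth], so that [s] is total. *)
Lemma card_eq_transport (T : finType) (A B : {set T}) : #|A| = #|B| ->
  exists2 s : T -> T, {in A &, injective s} & [set s x | x in A]%SET = B.
Proof.
move=> AB; pose s x := nth x (enum B) (index x (enum A)).
have idx x : x \in A -> (index x (enum A) < size (enum B))%N.
  by move=> xA; rewrite -cardE -AB cardE index_mem mem_enum.
have sinj : {in A &, injective s}.
  move=> x y xA yA; rewrite /s [RHS](set_nth_default x) ?idx //.
  move=> /eqP; rewrite nth_uniq ?idx ?enum_uniq // => /eqP xy.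
  by rewrite -(@nth_index _ x x (enum A)) ?mem_enum // xy nth_index ?mem_enum.
exists s => //; apply/eqP; rewrite eqEcard card_in_imset // AB leqnn andbT.
apply/fintype.subsetP => _ /imsetP[x xA ->].
by rewrite -mem_enum mem_nth ?idx.
Qed.

(** * Exponents as multisets of indices *)

Section Exponents.
Variable N : nat.

Definition exponent_of k (mu : 'I_k -> 'I_N) : 'X_{1..N} := (\sum_j U_(mu j))%MM.

Lemma mdeg_exponent_of k (mu : 'I_k -> 'I_N) : mdeg (exponent_of mu) = k.
Proof.
rewrite mdeg_sum (eq_bigr (fun=> 1%N)) => [|j _]; last exact: mdeg1.
by rewrite sum1_card card_ord.
Qed.

Lemma exponent_ofE k (mu : 'I_k -> 'I_N) i :
  exponent_of mu i = #|[set j | mu j == i]%SET|.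
Proof.
rewrite mnm_sumE -sum1dep_card [RHS]big_mkcond /=.
by apply: eq_bigr => j _; rewrite mnm1E; case: eqP.
Qed.

Lemma mnm_seq (m : 'X_{1..N}) : exists s : seq 'I_N, m = (\sum_(i <- s) U_(i))%MM.
Proof.
rewrite (multinomUE_id m).
apply: (big_ind (fun m => exists s : seq 'I_N, m = (\sum_(i <- s) U_(i))%MM)).
- by exists [::]; rewrite big_nil.
- by move=> _ _ [s ->] [s' ->]; exists (s ++ s'); rewrite big_cat.
move=> i _; elim: (m i) => [|k [s sE]].
  by exists [::]; rewrite big_nil mulm0n.
by exists (i :: s); rewrite big_cons -sE mulmS.
Qed.

Lemma mdeg_seq (s : seq 'I_N) : mdeg (\sum_(i <- s) U_(i))%MM = size s.
Proof.
rewrite mdeg_sum (eq_bigr (fun=> 1%N)) => [|j _]; last exact: mdeg1.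
by rewrite sum1_size.
Qed.

Lemma exponent_of_tnth k (t : k.-tuple 'I_N) :
  exponent_of (tnth t) = (\sum_(i <- t) U_(i))%MM.
Proof. by rewrite /exponent_of big_tuple. Qed.

End Exponents.

(** * Chains of recolorings *)

Section ColoringEquiv.
Variables (V : finType) (H : multigraph V) (k r : nat).
Implicit Types f g h : {ffun medge H -> 'I_k}.

Lemma coloring_equiv_refl f : is_edge_coloring f -> coloring_equiv r f f.
Proof. by move=> fc; exists 0%N, (fun=> f). Qed.

Lemma coloring_equiv_trans f g h :
  coloring_equiv r f g -> coloring_equiv r g h -> coloring_equiv r f h.
Proof.
move=> [s [F [F0 Fs Fc Fd]]] [s' [F' [F'0 F's F'c F'd]]].
exists (s + s')%N, (fun i => if (i <= s)%N then F i else F' (i - s)%N); split=> //.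
- case: ifP => le; last by rewrite addKn F's.
  have s'0 : s' = 0%N by lia.
  by rewrite -F's s'0 F'0 addn0 Fs.
- by move=> i le; case: ifP => [|/negbT] h1; [apply: Fc | apply: F'c; lia].
move=> i lt; have [lt1|le1] := ltnP i s.
  by rewrite (ltnW lt1); apply: Fd.
have [->|ne] := eqVneq i s.
  by rewrite leqnn Fs -F'0 subSnn; apply: F'd; lia.
have -> : (i <= s)%N = false by lia.
by rewrite subSn //; apply: F'd; lia.
Qed.

(** [differ_by] asks for the exact set of changed colors; here any set [T] containing them
    suffices. *)
Lemma coloring_equiv_step f g :
  is_edge_coloring f -> is_edge_coloring g ->
  forall T : {set 'I_k}, (#|T| <= r)%N ->
  (forall j, j \notin T -> color_class f j = color_class g j) ->
  coloring_equiv r f g.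
Proof.
move=> fc gc T Tr fg.
exists 1%N, (fun i => if i is 0 then f else g); split=> // [[]//|[|//] _].
pose S := [set j | color_class f j != color_class g j]%SET.
exists #|S|.
  apply: leq_trans Tr; apply/subset_leq_card/fintype.subsetP => j; rewrite inE.
  by apply: contraNT => /fg ->.
exists S; split=> // j; first by rewrite inE => /eqP.
by rewrite inE negbK => /eqP.
Qed.

End ColoringEquiv.

(** * Colorings by perfect matchings and their exponents *)

Section Colorings.
Variables (V : finType) (G : simple_graph V) (N : nat).
(** The matchings are kept abstract through the incidence relation of an enumeration; the three
    hypotheses say that it lists every perfect matching exactly once. *)
Variable B : 'I_N -> 'I_#|edges G| -> bool.
Hypothesis Bmatching : forall i,
  is_perfect_matching G [set edge e | e in [set e | B i e]]%SET.
Hypothesis Ball : forall M, is_perfect_matching G M ->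
  exists i, forall e, B i e = (edge e \in M).
Hypothesis Binj : forall i i', B i =1 B i' -> i = i'.

Lemma edge_inj : injective (@edge V G).
Proof. exact: enum_val_inj. Qed.

Lemma edge_neq0 (e : 'I_#|edges G|) : edge e != finset.set0.
Proof.
rewrite /edge; have /imsetP[[x y] _ ->] := enum_valP e.
by apply/finset.set0Pn; exists x; rewrite !inE eqxx.
Qed.

Lemma B_disjoint i e e' : B i e -> B i e' -> e != e' -> [disjoint edge e & edge e'].
Proof.
move=> Be Be' ne; have /and3P[_ /finset.trivIsetP triv _] := Bmatching i.
apply: triv; rewrite ?imset_f ?inE //.
by rewrite (inj_eq edge_inj).
Qed.

Section FixedMultiplicities.
Variables (a : 'I_#|edges G| -> nat) (k : nat).
Notation H := (edge_replication a).
Implicit Types (F f g : {ffun medge H -> 'I_k}) (mu nu : 'I_k -> 'I_N).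

Definition copy (e : 'I_#|edges G|) (c : 'I_(a e)) : medge H :=
  Tagged (fun i => 'I_(a i)) c.

Lemma copy_inj e : injective (@copy e).
Proof. by move=> c c' /eqP; rewrite eq_Tagged => /eqP. Qed.

(** Combines properness with the choice of matchings: the copies of [e] are in bijection with the
    colors whose matching contains [e]. *)
Definition colored_by F mu :=
  (forall e, injective (fun c : 'I_(a e) => F (copy c))) /\
  (forall j e, B (mu j) e <-> exists c : 'I_(a e), F (copy c) = j).

Lemma medge_ind (P : medge H -> Prop) : (forall e (c : 'I_(a e)), P (copy c)) ->
  forall x, P x.
Proof. by move=> HP [e c]; apply: HP. Qed.

Lemma colored_by_coloring F mu : colored_by F mu -> is_edge_coloring F.
Proof.
move=> [Finj FB]; elim/medge_ind => e c; elim/medge_ind => e' c' ne nd.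
apply/eqP => Fcc'; have [ee'|nee'] := eqVneq e e'.
  by subst e'; rewrite (Finj e _ _ Fcc') eqxx in ne.
have Be : B (mu (F (copy c))) e by apply/FB; exists c.
have Be' : B (mu (F (copy c))) e' by apply/FB; exists c'.
by move: nd; rewrite (B_disjoint Be Be' nee').
Qed.

Lemma colored_by_matching F mu : colored_by F mu ->
  forall j, color_perfect_matching F j.
Proof.
move=> [_ FB] j; rewrite /color_perfect_matching.
rewrite (_ : [set mends e | e in color_class F j]%SET =
  [set edge e | e in [set e | B (mu j) e]]%SET); first exact: Bmatching.
apply/setP => A; apply/imsetP/imsetP => [[]|[e]].
  elim/medge_ind => e c; rewrite inE => /eqP Fj ->.
  by exists e => //; rewrite inE; apply/FB; exists c.
by rewrite inE => /FB[c Fj] ->; exists (copy c); rewrite // inE Fj.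
Qed.

Lemma coloring_colored_by F : is_edge_coloring F ->
  (forall j, color_perfect_matching F j) -> exists mu, colored_by F mu.
Proof.
move=> Fc Fpm.
have [mu muP] := choice (fun j => Ball (Fpm j)).
exists mu; split.
  move=> e c c' Fcc'; apply/eqP/negPn/negP => ne.
  suff : F (copy c) != F (copy c') by rewrite Fcc' eqxx.
  apply: Fc; last by rewrite /= -finset.setI_eq0 finset.setIid edge_neq0.
  by rewrite (inj_eq (@copy_inj e)).
move=> j e; rewrite muP; split=> [/imsetP[]|[c Fj]].
  elim/medge_ind => e' c'; rewrite inE => /eqP Fj /edge_inj /= ee'.
  by subst e'; exists c'.
by apply/imsetP; exists (copy c); rewrite // inE Fj.
Qed.

Lemma colored_by_uniq F mu nu : colored_by F mu -> colored_by F nu -> mu =1 nu.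
Proof.
move=> [_ Fmu] [_ Fnu] j; apply: Binj => e.
by apply/idP/idP => [/Fmu/Fnu|/Fnu/Fmu].
Qed.

Lemma colored_by_card F mu : colored_by F mu ->
  forall e, #|[set j | B (mu j) e]%SET| = a e.
Proof.
move=> [Finj FB] e; rewrite -[RHS]card_ord -(card_imset _ (Finj e)).
congr #|pred_of_set _|; apply/setP => j; rewrite inE.
apply/idP/imsetP => [/FB[c <-]|[c _ ->]]; first by exists c.
by apply/FB; exists c.
Qed.

Lemma exists_colored_by mu : (forall e, #|[set j | B (mu j) e]%SET| = a e) ->
  exists F, colored_by F mu.
Proof.
(* The copy of rank [c] of an edge receives the color of rank [c] among those whose matching
   contains it. *)
move=> Hc; pose F0 (x : medge H) : 'I_k :=
  enum_val (cast_ord (esym (Hc (tag x))) (tagged x)).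
exists (finfun F0); split=> [e c c'|j e].
  by rewrite !ffunE => /enum_val_inj /cast_ord_inj.
split=> [Bj|[c]].
  have jS : j \in [set j | B (mu j) e]%SET by rewrite inE.
  exists (cast_ord (Hc e) (enum_rank_in jS j)).
  by rewrite ffunE /F0 /= cast_ordK enum_rankK_in.
rewrite ffunE => <-.
by have := enum_valP (cast_ord (esym (Hc e)) c); rewrite inE.
Qed.

(* On the copies of each edge e, compose F with a bijection between the colors
   whose matching changes and contains e before, respectively after. *)
Lemma recolor F mu nu : colored_by F mu ->
  (forall e, #|[set j | B (nu j) e]%SET| = a e) ->
  exists2 F', colored_by F' nu & forall j, mu j = nu j ->
    color_class F j = color_class F' j.
Proof.
move=> Fmu Hnu; pose T := [set j | mu j != nu j]%SET.
pose A e := [set j in T | B (mu j) e]%SET.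
pose A' e := [set j in T | B (nu j) e]%SET.
have AA' e : #|A e| = #|A' e|.
  have := colored_by_card Fmu e; rewrite -(Hnu e).
  rewrite -(cardsID T) -[in RHS](cardsID T).
  have -> : ([set j | B (mu j) e] :&: T = A e)%SET.
    by apply/setP => j; rewrite !inE andbC.
  have -> : ([set j | B (nu j) e] :&: T = A' e)%SET.
    by apply/setP => j; rewrite !inE andbC.
  (* Outside [T] the two families of matchings coincide, so equal totals give equal counts inside
     [T]. *)
  suff -> : ([set j | B (mu j) e] :\: T = [set j | B (nu j) e] :\: T)%SET.
    by move/addIn.
  by apply/setP => j; rewrite !inE; case: eqP => //= ->.
have /choice[s sP] : forall e, exists s : 'I_k -> 'I_k,
    {in A e &, injective s} /\ [set s x | x in A e]%SET = A' e.
  by move=> e; have [s] := card_eq_transport (AA' e); exists s.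
case: Fmu => Finj FB.
pose s' e j := if j \in T then s e j else j.
(* Colors in [T] move within [T], so a color outside [T] keeps exactly its copies, not merely its
   matching. *)
have s'T e j : B (mu j) e -> (s' e j \in T) = (j \in T).
  rewrite /s'; case: ifP => // jT Bj.
  have : s e j \in A' e by rewrite -(sP e).2 imset_f // inE jT.
  by rewrite inE => /andP[->].
pose F' := [ffun x : medge H => s' (tag x) (F x)].
have F'E e (c : 'I_(a e)) : F' (copy c) = s' e (F (copy c)) by rewrite ffunE.
have FBc e (c : 'I_(a e)) : B (mu (F (copy c))) e by apply/FB; exists c.
exists F'; last first.
  move=> j muj; have jT : j \notin T by rewrite inE muj eqxx.
  apply/setP; elim/medge_ind => e c; rewrite !inE F'E.
  have := s'T e _ (FBc _ c); rewrite /s'; case: ifP => // FT sT.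
  apply/eqP/eqP => jE; first by rewrite -jE FT in jT.
  by rewrite -jE sT in jT.
split=> [e c c'|j e].
  rewrite !F'E => eq; apply: (Finj e); move: (s'T e _ (FBc _ c)) (s'T e _ (FBc _ c')).
  rewrite eq => -> ; move: eq; rewrite /s'.
  case: ifP => cT; case: ifP => c'T // eq _.
  by apply: (sP e).1 eq; rewrite inE ?cT ?c'T FBc.
have [jT|jT] := boolP (j \in T); last first.
  have muj : mu j = nu j by apply/eqP; move: jT; rewrite inE negbK.
  rewrite -muj; split=> [/FB[c Fc]|[c]].
    by exists c; rewrite F'E /s' Fc (negPf jT).
  rewrite F'E => sE; apply/FB; exists c; move: sE (s'T e _ (FBc _ c)).
  by rewrite /s'; case: ifP => // _ ->; rewrite (negPf jT).
split=> [Bj|[c]].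
  have : j \in A' e by rewrite inE jT.
  rewrite -(sP e).2 => /imsetP[i]; rewrite inE => /andP[iT /FB[c Fc]] ->.
  by exists c; rewrite F'E /s' Fc iT.
rewrite F'E => sE; have := s'T e _ (FBc _ c); rewrite sE jT => /esym FT.
have : j \in A' e; last by rewrite inE jT.
by rewrite -sE /s' FT -(sP e).2 imset_f // inE FT FBc.
Qed.

(** Group the colors by their matching. Edge multiplicities thus depend on the exponent alone. *)
Lemma card_exponent_of mu e :
  #|[set j | B (mu j) e]%SET| = (\sum_(i | B i e) exponent_of mu i)%N.
Proof.
rewrite -sum1dep_card (partition_big mu (fun i => B i e)) //=.
apply: eq_bigr => i Bi; rewrite exponent_ofE -sum1dep_card.
apply: eq_bigl => j; apply/andP/eqP => [[_ /eqP //]|->]; by rewrite eqxx.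
Qed.

Lemma exponent_of_card mu nu : exponent_of mu = exponent_of nu ->
  forall e, #|[set j | B (mu j) e]%SET| = #|[set j | B (nu j) e]%SET|.
Proof. by move=> munu e; rewrite !card_exponent_of munu. Qed.

(** Edges in one class are pairwise disjoint, so covered vertices are counted by edge ends; as edges
    are nonempty, distinct copies in the class also have distinct end sets. *)
Lemma coloring_class_cover F j : is_edge_coloring F ->
  let M := [set mends e | e in color_class F j]%SET in
  finset.trivIset M /\ #|finset.cover M| = (\sum_(x | F x == j) #|mends x|)%N.
Proof.
move=> Fc M.
have dis x y : F x = j -> F y = j -> x != y -> [disjoint mends x & mends y].
  move=> Fx Fy xy; apply/negPn/negP => nd.
  by have := Fc x y xy nd; rewrite Fx Fy eqxx.
have triv : finset.trivIset M.
  apply/finset.trivIsetP => _ _ /imsetP[x + ->] /imsetP[y + ->].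
  rewrite !inE => /eqP Fx /eqP Fy ne; apply: dis => //.
  by apply: contraNneq ne => ->.
split=> //; have := triv; rewrite /finset.trivIset => /eqP <-.
rewrite big_imset /=; first by apply: eq_bigl => x; rewrite inE.
move=> x y; rewrite !inE => /eqP Fx /eqP Fy xy; apply/eqP/negPn/negP => ne.
have := dis x y Fx Fy ne; rewrite /= xy -finset.setI_eq0 finset.setIid.
exact/negP/edge_neq0.
Qed.

(* Both colorings have k classes covering together the same number of edge
   ends, and no class of a proper coloring covers more than all vertices. *)
Lemma coloring_matching f F : is_edge_coloring f ->
  (forall j, color_perfect_matching f j) -> is_edge_coloring F ->
  forall j, color_perfect_matching F j.
Proof.
move=> fc fpm Fc.
pose C F j := finset.cover [set mends e | e in color_class F j]%SET.
have sumC F' : is_edge_coloring F' ->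
    (\sum_j #|C F' j| = \sum_(x : medge H) #|mends x|)%N.
  move=> F'c; rewrite [RHS](partition_big F' xpredT) //=.
  by apply: eq_bigr => j _; have [_] := coloring_class_cover j F'c.
have fV j : #|C f j| = #|V|.
  by have /and3P[_ _ /eqP] := fpm j; rewrite /C => ->; rewrite cardsT.
have le j : (#|C F j| <= #|V|)%N by apply: max_card.
have FV j : #|C F j| = #|V|.
  apply/eqP; rewrite eqn_leq le /=.
  have : (\sum_j #|C F j| = \sum_j #|C f j|)%N by rewrite !sumC.
  rewrite (bigD1 j) //= [RHS](bigD1 j) //= fV => E.
  rewrite -(leq_add2r (\sum_(i | i != j) #|C F i|)) E leq_add2l.
  by apply: leq_sum => i _; rewrite fV.
move=> j; apply/and3P; split.
- by apply/fintype.subsetP => _ /imsetP[x _ ->]; apply: enum_valP.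
- by have [] := coloring_class_cover j Fc.
- by rewrite eqEcard finset.subsetT cardsT -(FV j) leqnn.
Qed.

(** * Reordering parallel copies and colors, two colors at a time *)

Variable r : nat.
Hypothesis r2 : (2 <= r)%N.

(** Induction on the number of copies colored differently. At such a copy [c] of [e], the colors
    [f c] and [g c] are exchanged on the copies of [e] only; both matchings contain [e], so [mu] is
    preserved. *)
Lemma swap_copies f g mu : colored_by f mu -> colored_by g mu ->
  coloring_equiv r f g.
Proof.
move: {2}(#|_|) (leqnn #|[set x | f x != g x]%SET|) => n.
elim: n f => [|n IH] f.
  rewrite leqn0 cards_eq0 => /eqP fg fmu gmu.
  suff -> : f = g by apply/coloring_equiv_refl/(colored_by_coloring gmu).
  apply/ffunP => x; apply/eqP/negPn/negP => nx.
  by have := finset.in_set0 x; rewrite -fg inE nx.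
move=> le fmu gmu; have [fg|] := eqVneq [set x | f x != g x]%SET finset.set0.
  by apply: IH; rewrite ?fg ?finset.cards0.
case/finset.set0Pn; elim/medge_ind => e c; rewrite inE => fgc.
have : B (mu (g (copy c))) e by apply/gmu.2; exists c.
move/fmu.2 => [c' fc'].
pose s := tperm (f (copy c)) (g (copy c)).
have sB j : B (mu (s j)) e = B (mu j) e.
  have Bf : B (mu (f (copy c))) e by apply/fmu.2; exists c.
  have Bg : B (mu (g (copy c))) e by apply/gmu.2; exists c.
  by rewrite /s; case: tpermP => [->|->|//]; rewrite Bf Bg.
pose f' := [ffun x : medge H => if tag x == e then s (f x) else f x].
have f'mu : colored_by f' mu.
  split=> [e' d d'|j e'].
    rewrite !ffunE /=; case: ifP => _ => [/perm_inj|]; exact: fmu.1.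
  have [->|ne] := eqVneq e' e; last first.
    by rewrite fmu.2; split=> -[d dj]; exists d; move: dj; rewrite ffunE /= (negPf ne).
  rewrite -sB fmu.2; split=> -[d dj]; exists d; move: dj; rewrite ffunE /= eqxx.
    by move=> ->; rewrite /s tpermK.
  by move=> <-; rewrite /s tpermK.
apply: coloring_equiv_trans (IH f' _ f'mu gmu).
  apply: (coloring_equiv_step (colored_by_coloring fmu) (colored_by_coloring f'mu)
    (T := [set f (copy c); g (copy c)]%SET)).
    by apply: leq_trans r2; rewrite cards2; case: (_ != _).
  move=> j; rewrite !inE negb_or => /andP[jf jg].
  apply/setP => x; rewrite !inE ffunE; case: ifP => // _.
  rewrite -[in RHS](tpermD (_ : f (copy c) != j) (_ : g (copy c) != j)) 1?eq_sym //.
  by rewrite (inj_eq perm_inj).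
rewrite -ltnS (leq_trans _ le) //; apply: proper_card; apply/fintype.properP; split.
  (* A copy of [e] other than [c] on which [f] and [g] agree has neither of the two exchanged
     colors, so it stays correct. *)
  apply/fintype.subsetP; elim/medge_ind => e' d; rewrite !inE ffunE /=.
  have [ee'|//] := eqVneq e' e; subst e'; apply: contraNneq => fg.
  have [->|nd] := eqVneq d c; first by rewrite /s tpermL.
  rewrite /s tpermD -?fg //; first by rewrite (inj_eq (fmu.1 e)) eq_sym.
  by rewrite fg (inj_eq (gmu.1 e)) eq_sym.
by exists (copy c); rewrite !inE // ffunE /= eqxx negbK /s tpermL.
Qed.

(** Induction on the number of colors with different matchings: a transposition gives [j] its target
    matching, and [recolor] realizes it by changing two classes. [swap_copies] finishes when [mu]
    and [nu] agree. *)
Lemma swap_colors f g mu nu : colored_by f mu -> colored_by g nu ->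
  exponent_of mu = exponent_of nu -> coloring_equiv r f g.
Proof.
move: {2}(#|_|) (leqnn #|[set j | mu j != nu j]%SET|) => n.
elim: n f mu => [|n IH] f mu.
  rewrite leqn0 cards_eq0 => /eqP munu fmu gnu _.
  have munuE : mu =1 nu.
    move=> j; apply/eqP/negPn/negP => nj.
    by have := finset.in_set0 j; rewrite -munu inE nj.
  apply: (swap_copies (mu := mu)) => //.
  split=> [|j e]; [exact: gnu.1 | rewrite munuE; exact: gnu.2].
move=> le fmu gnu munu; have [D0|] := eqVneq [set j | mu j != nu j]%SET finset.set0.
  by apply: (IH f mu); rewrite ?D0 ?finset.cards0.
case/finset.set0Pn=> j; rewrite inE => nj.
(* Otherwise the colors sent to [nu j] by [mu] would lie among those sent there by [nu]; equal
   counts would make the two sets equal, but [j] is only in the second. *)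
have [j' /andP[/eqP muj' nuj']] : exists j', (mu j' == nu j) && (nu j' != nu j).
  apply/existsP; apply: contraNT nj => /existsPn H.
  have sub : ([set i | mu i == nu j] \subset [set i | nu i == nu j])%SET.
    apply/fintype.subsetP => i; rewrite !inE => mi.
    by have := H i; rewrite mi negbK.
  have : j \in [set i | nu i == nu j]%SET by rewrite inE.
  have /eqP <- : [set i | mu i == nu j]%SET == [set i | nu i == nu j]%SET.
    by rewrite eqEcard sub -!exponent_ofE munu leqnn.
  by rewrite inE.
pose mu1 := mu \o tperm j j'.
have mu1E : exponent_of mu1 = exponent_of mu.
  by rewrite /exponent_of [RHS](reindex_inj (@perm_inj _ (tperm j j'))).
have [f1 f1mu ff1] := recolor (nu := mu1) fmu
  (fun e => etrans (exponent_of_card mu1E e) (colored_by_card fmu e)).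
apply: coloring_equiv_trans (IH f1 mu1 _ f1mu gnu (etrans mu1E munu)).
  apply: (coloring_equiv_step (colored_by_coloring fmu) (colored_by_coloring f1mu)
    (T := [set j; j']%SET)).
    by apply: leq_trans r2; rewrite cards2; case: (_ != _).
  move=> i; rewrite !inE negb_or => /andP[ij ij']; apply: ff1.
  by rewrite /mu1 /= tpermD // eq_sym.
rewrite -ltnS (leq_trans _ le) //; apply: proper_card; apply/fintype.properP; split.
  apply/fintype.subsetP => i; rewrite !inE /mu1 /=.
  case: tpermP => [->|->|//]; first by rewrite nj.
  by move=> _; rewrite muj' eq_sym.
by exists j; rewrite !inE // /mu1 /= tpermL muj' eqxx.
Qed.

End FixedMultiplicities.

(** * Moves between exponents versus steps between colorings *)

Variables (p : nat) (b : 'I_N -> 'X_{1..p}).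
Hypothesis bP : forall u v, mon_image b u = mon_image b v <->
  (forall e, \sum_(i | B i e) u i = \sum_(i | B i e) v i)%N /\ mdeg u = mdeg v.

Section Connect.
Variable r : nat.
Hypothesis r2 : (2 <= r)%N.

(** Reorder the colors so that [w] occupies the first positions and [x] the last [mdeg x]; replacing
    [x] by [y] then recolors only the latter. *)
Lemma move_recolor (a : 'I_#|edges G| -> nat) k (f : {ffun medge (edge_replication a) -> 'I_k}) mu v :
  colored_by f mu -> move_le b r (exponent_of mu) v ->
  exists g nu, [/\ colored_by g nu, exponent_of nu = v & coloring_equiv r f g].
Proof.
move=> fmu [w [x [y [muE vE xy xr]]]].
have [sw swE] := mnm_seq w; have [sx sxE] := mnm_seq x; have [sy syE] := mnm_seq y.
have xyd : mdeg x = mdeg y by have /bP[] := xy.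
have szx : size (sw ++ sx) == k.
  by rewrite size_cat -!mdeg_seq -swE -sxE -mdegD -muE mdeg_exponent_of.
have szy : size (sw ++ sy) == k.
  by rewrite -(eqP szx) !size_cat -!mdeg_seq -sxE -syE xyd.
pose mu0 := tnth (Tuple szx); pose nu := tnth (Tuple szy).
have mu0E : exponent_of mu0 = exponent_of mu.
  by rewrite exponent_of_tnth big_cat -swE -sxE.
have nuE : exponent_of nu = v by rewrite exponent_of_tnth big_cat -swE -syE.
have mu0a e : #|[set j | B (mu0 j) e]%SET| = a e.
  by rewrite (exponent_of_card mu0E) (colored_by_card fmu).
have nua e : #|[set j | B (nu j) e]%SET| = a e.
  rewrite -(colored_by_card fmu) !card_exponent_of nuE vE muE.
  have /bP[/(_ e) xye _] := xy.
  transitivity (\sum_(i | B i e) w i + \sum_(i | B i e) y i)%N.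
    by rewrite -big_split; apply: eq_bigr => i _; rewrite mnmDE.
  by rewrite -xye -big_split; apply: eq_bigr => i _; rewrite mnmDE.
have [f0 f0mu0] := exists_colored_by mu0a.
have [g gnu f0g] := recolor f0mu0 nua.
exists g, nu; split=> //; apply: coloring_equiv_trans (swap_colors r2 fmu f0mu0 _) _ => //.
apply: (coloring_equiv_step (colored_by_coloring f0mu0) (colored_by_coloring gnu)
  (T := [set j | mu0 j != nu j]%SET)) => [|j]; last first.
  by rewrite inE negbK => /eqP /f0g.
apply: leq_trans xr; rewrite sxE mdeg_seq.
(* The two words share their first [size sw] letters, so at most [size sx] colors change. *)
apply: (@leq_trans #|[set j : 'I_k | (size sw <= j)%N]%SET|).
  apply/subset_leq_card/fintype.subsetP => j; rewrite !inE.
  apply: contraR; rewrite -ltnNge => lt; apply/eqP.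
  by rewrite /mu0 /nu !(tnth_nth (mu0 j)) /= !nth_cat lt.
rewrite -sum1dep_card -(big_geq_mkord _ _ xpredT (fun=> 1%N)) sum_nat_const_nat muln1.
by rewrite -(eqP szx) size_cat addKn.
Qed.

Lemma moves_recolor (a : 'I_#|edges G| -> nat) k u v : moves_le b r u v ->
  forall (f : {ffun medge (edge_replication a) -> 'I_k}) mu,
  colored_by f mu -> exponent_of mu = u ->
  exists g nu, [/\ colored_by g nu, exponent_of nu = v & coloring_equiv r f g].
Proof.
elim=> {u v} [u v uv|u|u v w _ IH1 _ IH2] f mu fmu muE.
- by apply: move_recolor fmu _; rewrite muE.
- by exists f, mu; split=> //; apply/coloring_equiv_refl/colored_by_coloring/fmu.
have [g [nu [gnu nuE fg]]] := IH1 f mu fmu muE.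
have [h [xi [hxi xiE gh]]] := IH2 g nu gnu nuE.
by exists h, xi; split=> //; apply: coloring_equiv_trans gh.
Qed.

Lemma moves_coloring_equiv (a : 'I_#|edges G| -> nat) k
    (f g : {ffun medge (edge_replication a) -> 'I_k}) :
  (forall u v, mon_image b u = mon_image b v -> moves_le b r u v) ->
  is_edge_coloring f -> is_edge_coloring g ->
  (forall j, color_perfect_matching f j) ->
  (forall j, color_perfect_matching g j) -> coloring_equiv r f g.
Proof.
move=> conn fc gc fpm gpm.
have [mu fmu] := coloring_colored_by fc fpm.
have [nu gnu] := coloring_colored_by gc gpm.
have munu : moves_le b r (exponent_of mu) (exponent_of nu).
  apply/conn/bP; rewrite !mdeg_exponent_of; split=> // e.
  by rewrite -!card_exponent_of (colored_by_card fmu) (colored_by_card gnu).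
have [f' [mu' [f'mu' mu'nu ff']]] := moves_recolor munu fmu erefl.
exact: coloring_equiv_trans ff' (swap_colors r2 f'mu' gnu mu'nu).
Qed.

End Connect.

(** By [coloring_matching] every coloring along the chain has an exponent, and each link is a move
    in which the changed colors provide [x] and [y]. *)
Lemma coloring_equiv_moves r (a : 'I_#|edges G| -> nat) k
    (f g : {ffun medge (edge_replication a) -> 'I_k})
    mu nu :
  colored_by f mu -> colored_by g nu -> coloring_equiv r f g ->
  moves_le b r (exponent_of mu) (exponent_of nu).
Proof.
move=> fmu gnu [s [F [F0 Fs Fc Fd]]].
have Fmu i : (i <= s)%N -> exists mu', colored_by (F i) mu'.
  move=> le; apply: coloring_colored_by; first exact: Fc.
  exact: coloring_matching (colored_by_coloring fmu) (colored_by_matching fmu) (Fc _ le).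
suff H i : (i <= s)%N -> forall mu', colored_by (F i) mu' ->
    moves_le b r (exponent_of mu) (exponent_of mu').
  by apply: (H s) => //; rewrite Fs.
elim: i => [_|i IH lt] mu' Fmu'.
  rewrite F0 in Fmu'.
  have -> : mu' = mu by apply/funext/(colored_by_uniq Fmu' fmu).
  exact: rt_refl.
have [mu1 Fmu1] := Fmu i (ltnW lt).
apply: (rt_trans _ _ _ _ _ (IH (ltnW lt) _ Fmu1)); apply: rt_step.
have [m mr [S [Sm _ SF]]] := Fd i lt.
have muS j : j \notin S -> mu1 j = mu' j.
  move=> /SF E; apply: Binj => e.
  have FE (c : 'I_(a e)) : (F i (copy c) == j) = (F i.+1 (copy c) == j).
    by move/setP/(_ (copy c)): E; rewrite !inE.
  apply/idP/idP => [/Fmu1.2|/Fmu'.2] [c /eqP Fc'].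
    by apply/Fmu'.2; exists c; apply/eqP; rewrite -FE.
  by apply/Fmu1.2; exists c; apply/eqP; rewrite FE.
pose part (nu : 'I_k -> 'I_N) (P : pred 'I_k) := (\sum_(j | P j) U_(nu j))%MM : 'X_{1..N}.
have split nu' : exponent_of nu' = (part nu' (predC (mem S)) + part nu' (mem S))%MM.
  by rewrite /exponent_of (bigID (mem S)) addmC.
have wE : part mu1 (predC (mem S)) = part mu' (predC (mem S)).
  by apply: eq_bigr => j jS; rewrite muS.
exists (part mu1 (predC (mem S))), (part mu1 (mem S)), (part mu' (mem S)).
split=> //; first by rewrite wE.
  (* Both full exponents have multiplicities [a] and degree [k], hence equal images; the common part
     outside [S] cancels. *)
  apply: (@addmI _ (mon_image b (part mu1 (predC (mem S))))).
  rewrite {2}wE -!mon_imageD -!split; apply/bP.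
  rewrite !mdeg_exponent_of; split=> // e.
  by rewrite -!card_exponent_of (colored_by_card Fmu1) (colored_by_card Fmu').
rewrite /part mdeg_sum (eq_bigr (fun=> 1%N)) => [|j _]; last exact: mdeg1.
by rewrite sum1_card Sm.
Qed.

Lemma coloring_equiv_fibre r :
  (forall (a : 'I_#|edges G| -> nat) k (f g : {ffun medge (edge_replication a) -> 'I_k}),
     is_edge_coloring f -> is_edge_coloring g ->
     (forall j, color_perfect_matching f j) ->
     (forall j, color_perfect_matching g j) -> coloring_equiv r f g) ->
  forall u v, mon_image b u = mon_image b v -> moves_le b r u v.
Proof.
move=> conn u v uv; have [su suE] := mnm_seq u; have [sv svE] := mnm_seq v.
have /bP[uvA uvd] := uv.
have szv : size sv == size su by rewrite -!mdeg_seq -suE -svE uvd.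
pose mu := tnth (in_tuple su); pose nu := tnth (Tuple szv).
have muE : exponent_of mu = u by rewrite exponent_of_tnth -suE.
have nuE : exponent_of nu = v by rewrite exponent_of_tnth -svE.
(* The edge multiplicities of the matchings listed in [u]; by [uvA] those of [v] are the same, so
   both color one multigraph. *)
pose a e := (\sum_(i | B i e) u i)%N.
have [f fmu] : exists f : {ffun medge (edge_replication a) -> _}, colored_by f mu.
  by apply: exists_colored_by => e; rewrite card_exponent_of muE.
have [g gnu] : exists g : {ffun medge (edge_replication a) -> _}, colored_by g nu.
  by apply: exists_colored_by => e; rewrite card_exponent_of nuE -uvA.
rewrite -muE -nuE; apply: (coloring_equiv_moves fmu gnu).
apply: conn.
- exact: colored_by_coloring fmu.
- exact: colored_by_coloring gnu.
- exact: colored_by_matching fmu.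
- exact: colored_by_matching gnu.
Qed.

End Colorings.

(** * Lattice points of the perfect matching polytope *)

Section Polytope.
Variables (R : realType) (V : finType) (G : simple_graph V).

Lemma rhoE M j : rho R G M 0 j = (edge j \in M)%:R.
Proof.
rewrite /rho summxE big_mkcond (bigD1 j) //= big1 => [|i ij].
  by rewrite addr0; case: ifP; rewrite ?mxE ?eqxx.
by case: ifP => // _; rewrite mxE eq_sym (negPf ij).
Qed.

Definition indicator (M : {set {set V}}) : 'X_{1..#|edges G|} :=
  [multinom (edge j \in M : nat) | j < #|edges G|].

(** A lattice point of the polytope is a 0/1 vector, hence a vertex of the unit cube, so every
    matching of positive weight in a convex combination must represent it. *)
Lemma polytope_lattice (a : 'X_{1..#|edges G|}) :
  perfect_matching_polytope R G (\row_i (a i)%:R) <->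
  exists2 M, is_perfect_matching G M & a = indicator M.
Proof.
split=> [[m [c [q [qP c0 c1 aE]]]]|[M MP ->]]; last first.
  exists 1%N, (fun=> 1), (fun=> rho R G M); split.
  - by move=> _; exists M.
  - by [].
  - by rewrite big_ord1.
  by rewrite big_ord1 scale1r; apply/rowP => j; rewrite rhoE mxE mnmE.
have /choice[M MP] : forall i, exists M, is_perfect_matching G M /\ rho R G M = q i.
  by move=> i; have [M ? ?] := qP i; exists M.
have aj j : (a j)%:R = \sum_i c i * (edge j \in M i)%:R.
  have /rowP/(_ j) := aE; rewrite mxE summxE => ->.
  by apply: eq_bigr => i _; rewrite mxE -(MP i).2 rhoE.
have [i ci] : exists i, 0 < c i.
  apply/existsP; apply: contraT => /existsPn H.
  have : \sum_i c i = 0.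
    by apply: big1 => i _; apply: le_anti; rewrite c0 andbT leNgt H.
  by rewrite c1 => /eqP; rewrite oner_eq0.
exists (M i); first exact: (MP i).1.
apply/mnmP => j; rewrite mnmE.
have le1 : (a j)%:R <= 1 :> R.
  rewrite aj -[leRHS]c1; apply: ler_sum => i' _.
  by rewrite ler_piMr ?c0 ?lern1 ?leq_b1.
rewrite (ler_nat R _ 1) in le1.
(* For an edge of [M i] the coordinate is at least [c i > 0]; otherwise it is at most
   [1 - c i < 1]. *)
have [jM|jM] := boolP (edge j \in M i).
  apply/eqP; rewrite eqn_leq le1 /= -(ltr_nat R) aj (bigD1 i) //= jM mulr1.
  apply: ltr_wpDr => //; apply: sumr_ge0 => i' _.
  by rewrite mulr_ge0.
apply/eqP; rewrite -leqn0 -ltnS -(ltr_nat R) aj -[ltRHS]c1.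
rewrite (bigD1 i) //= [ltRHS](bigD1 i) //= (negPf jM) mulr0.
apply: ltr_leD => //; apply: ler_sum => i' _.
by rewrite ler_piMr ?c0 ?lern1 ?leq_b1.
Qed.

Lemma mem_lattice_points (a : 'X_{1..#|edges G|}) :
  a \in lattice_points (perfect_matching_polytope R G) <->
  exists2 M, is_perfect_matching G M & a = indicator M.
Proof.
rewrite -polytope_lattice /lattice_points.
rewrite -[_ \in enum_fset _]/(a \in fset_set _) in_fset_set.
  by split=> [/set_mem|/mem_set].
(* [fset_set] has the expected elements only for finite sets; finiteness holds as there are finitely
   many sets of edges. *)
apply: (@sub_finite_set _ _ (indicator @` setT)%classic).
  by move=> x /= /polytope_lattice[M _ ->]; exists M.
exact/finite_image/finite_finset.
Qed.

End Polytope.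

(** * Exponents of the toric map *)

Section ToricExponents.
Variables (n : nat) (L : seq 'X_{1..n}).

Definition toric_exponent (i : 'I_(size L)) : 'X_{1..n.+1} :=
  (mnmwiden (tnth (in_tuple L) i) + U_(ord_max))%MM.

Lemma tnth_toric_monomial (K : fieldType) i :
  tnth (map_tuple (@toric_monomial K n) (in_tuple L)) i = 'X_[toric_exponent i].
Proof. by rewrite tnth_map /toric_monomial mwidenX -mpolyXD. Qed.

Lemma mon_image_toric (u : 'X_{1..size L}) :
  mon_image toric_exponent u =
  (mnmwiden (mon_image (tnth (in_tuple L)) u) + U_(ord_max) *+ mdeg u)%MM.
Proof.
rewrite /mon_image mnmwiden_sum mdegE.
apply/mnmP => j; rewrite mnmDE !mnm_sumE mulmnE big_distrr -big_split /=.
apply: eq_bigr => i _; rewrite mulmnE mnmDE mulnDl; congr (_ + _)%N.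
have [lt|le] := ltnP j n.
  have -> : j = widen_ord (leqnSn n) (Ordinal lt) by apply: val_inj.
  by rewrite !mnmwiden_widen mulmnE.
have -> : j = ord_max by apply: val_inj => /=; have := ltn_ord j; lia.
by rewrite !mnmwiden_ordmax.
Qed.

(** The coordinate of the last variable reads off the degree, which is what makes the toric ideal
    homogeneous. *)
Lemma mon_image_toricP (u v : 'X_{1..size L}) :
  mon_image toric_exponent u = mon_image toric_exponent v <->
  mon_image (tnth (in_tuple L)) u = mon_image (tnth (in_tuple L)) v /\
  mdeg u = mdeg v.
Proof.
rewrite !mon_image_toric; split=> [E|[-> ->] //].
have uv : mdeg u = mdeg v.
  have /mnmP/(_ ord_max) := E.
  by rewrite !mnmDE !mnmwiden_ordmax !mulmnE mnm1E eqxx !mul1n.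
by split=> //; move: E; rewrite uv => /addIm/inj_mnmwiden.
Qed.

End ToricExponents.

Theorem proposition6p8 (R : realType) (K : fieldType) (V : finType)
    (G : simple_graph V) (r : nat) (hr : (2 <= r)%N) :
  (omega (toric_ideal K (perfect_matching_polytope R G)) <= r)%N <->
  (forall (a : 'I_#|edges G| -> nat) (k : nat)
     (f g : {ffun medge (edge_replication a) -> 'I_k}),
     is_edge_coloring f -> is_edge_coloring g ->
     (forall j : 'I_k, color_perfect_matching f j) ->
     (forall j : 'I_k, color_perfect_matching g j) ->
     coloring_equiv r f g).
Proof.
set P := perfect_matching_polytope R G; pose L := lattice_points P.
pose B (i : 'I_(size L)) e := tnth (in_tuple L) i e != 0%N.
have LB i : exists2 M, is_perfect_matching G M & forall e, B i e = (edge e \in M).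
  have /mem_lattice_points[M MP iM] := mem_tnth i (in_tuple L).
  by exists M => // e; rewrite /B iM mnmE; case: (_ \in _).
(* Lattice points are 0/1 vectors, so the nonvanishing test [B] determines them. *)
have lpB i e : tnth (in_tuple L) i e = B i e.
  have /mem_lattice_points[M MP iM] := mem_tnth i (in_tuple L).
  by rewrite /B iM mnmE; case: (_ \in _).
have Bmatching i : is_perfect_matching G [set edge e | e in [set e | B i e]]%SET.
  have [M MP iM] := LB i; rewrite (_ : imset _ _ = M) //.
  have /and3P[/fintype.subsetP ME _ _] := MP.
  apply/setP => A; apply/imsetP/idP => [[e + ->]|AM]; first by rewrite inE iM.
  exists (enum_rank_in (ME _ AM) A); last by rewrite /edge enum_rankK_in ?ME.
  by rewrite inE iM /edge enum_rankK_in ?ME.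
have Ball M : is_perfect_matching G M -> exists i, forall e, B i e = (edge e \in M).
  move=> MP; have /tnthP[i iM] : indicator G M \in in_tuple L.
    by apply/mem_lattice_points; exists M.
  by exists i => e; rewrite /B -iM mnmE; case: (_ \in _).
have Binj i i' : B i =1 B i' -> i = i'.
  move=> BB; have /tuple_uniqP inj : uniq (in_tuple L) by apply: fset_uniq.
  by apply: inj; apply/mnmP => e; rewrite !lpB BB.
have bP u v : mon_image (@toric_exponent _ L) u = mon_image (@toric_exponent _ L) v <->
    (forall e, \sum_(i | B i e) u i = \sum_(i | B i e) v i)%N /\ mdeg u = mdeg v.
  have E w e : mon_image (tnth (in_tuple L)) w e = (\sum_(i | B i e) w i)%N.
    rewrite mnm_sumE [RHS]big_mkcond; apply: eq_bigr => i _.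
    by rewrite mulmnE lpB; case: (B i e); rewrite ?mul1n.
  rewrite mon_image_toricP mnmP; split=> -[uv ->]; split=> // e.
    by rewrite -!E.
  by rewrite !E.
have image_deg u v : mon_image (@toric_exponent _ L) u = mon_image (@toric_exponent _ L) v ->
    mdeg u = mdeg v by case/bP.
have tE i := tnth_toric_monomial K i : tnth _ (i : 'I_(size L)) = _.
(* The toric ideal is by conversion the kernel of substituting the toric monomials, to which the
   fibre criteria apply. *)
rewrite -[toric_ideal K P]/(ker_set (map_tuple (@toric_monomial K _) (in_tuple L))).
split=> [om a k f g|conn].
  apply: (moves_coloring_equiv Bmatching Ball bP hr) => u v.
  exact: (omega_moves tE).
apply: (moves_omega tE) => // u v.
exact: (coloring_equiv_fibre Bmatching Ball Binj bP conn).
Qed.
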